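(* There exist absolute constants $K>1$ and $C>0$ and, for each $n$ and $\epsilon$, an algorithm such that the following holds for all sufficiently large $n$ and all $\epsilon\ge \frac{K\log^3 n}{n^{1/4}}$: the algorithm has sample complexity $m\le C\left(\frac{n}{\epsilon}\right)^{4/5}\log^{7/5}n$, receives only $\mathrm{trace}(S)$ for $S\sim\mathrm{samp}(\pi,m)$ where $\pi$ is a probability distribution on $[2n]$, and (i) if $\pi$ is the uniform distribution on $[2n]$ it accepts with probability at least $9/10$; (ii) if the total variation distance between $\pi$ and the uniform distribution on $[2n]$ exceeds $\epsilon$, it rejects with probability at least $9/10$.
   Context: $\log$ is the natural logarithm. For a multiset $S\subset\mathbb N$ of size $m$ with elements in sorted order $x_1\le\dots\le x_m$, $\mathrm{trace}(S)=(x_1\bmod 2,\dots,x_m\bmod 2)\in\{0,1\}^m$. $\mathrm{samp}(\pi,m)$ denotes the distribution of the multiset of $m$ independent samples from $\pi$. *)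

(* Defs.v *)
From HB Require Import structures.
From mathcomp Require Import all_boot all_order all_algebra.
From mathcomp Require Import reals exp.

Set Implicit Arguments.
Unset Strict Implicit.
Unset Printing Implicit Defensive.

Import Order.TTheory GRing.Theory Num.Theory.
Local Open Scope ring_scope.

Section FiniteDistributions.
Variables (R : realType) (T : finType).

Record fdist := FDist {
  pmf :> T -> R;
  pmf_ge0 : forall x, 0 <= pmf x;
  pmf_sum1 : \sum_(x : T) pmf x = 1 }.

(* A bare function rather than an fdist, since T may be empty. *)
Definition uniform_pmf : T -> R := fun=> #|T|%:R^-1.

Definition tv_dist (p q : T -> R) : R := 2^-1 * \sum_(x : T) `|p x - q x|.

(* Law of m independent samples, listed in drawing order; the order is
   forgotten by [trace], which only depends on the underlying multiset. *)
Definition samp (p : T -> R) (m : nat) (s : m.-tuple T) : R :=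
  \prod_(i < m) p (tnth s i).

End FiniteDistributions.

(* The bits 0 and 1 are encoded as false and true. *)
Definition trace (m : nat) (S : m.-tuple nat) : m.-tuple bool :=
  [tuple of map odd (sort leq S)].

(* The index i : 'I_k stands for the element i + 1 of [k] = {1, ..., k}; the
   shift matters for parities. *)
Definition sample_values (k m : nat) (s : m.-tuple 'I_k) : m.-tuple nat :=
  [tuple of map (fun i : 'I_k => i.+1) s].

(* A (possibly randomized) algorithm drawing [sample_size] samples: on input
   the trace t it accepts with probability [accept_prob t] over its internal
   coins, and rejects otherwise.  It is deterministic when [accept_prob] takes
   only the values 0 and 1. *)
Record trace_algorithm (R : realType) := TraceAlgorithm {
  sample_size : nat;
  accept_prob : sample_size.-tuple bool -> R;
  accept_prob_itv : forall t, 0 <= accept_prob t <= 1 }.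

Section Outcomes.
Variables (R : realType) (k : nat) (A : trace_algorithm R) (p : fdist R 'I_k).

(* Probabilities over both the samples and the internal coins. *)
Definition prob_accepts : R :=
  \sum_(s : (sample_size A).-tuple 'I_k)
    samp p s * accept_prob (trace (sample_values s)).

Definition prob_rejects : R :=
  \sum_(s : (sample_size A).-tuple 'I_k)
    samp p s * (1 - accept_prob (trace (sample_values s))).

End Outcomes.

(* Main.v *)
(* Let D be the number of sign changes in the trace.  Throw Poisson (m) many
   samples, so that the elements are present independently, element i being
   absent with probability q_i = exp (- m p_i).  Reading the elements from left
   to right, the bias b of the event "the last bit seen differs from the parity
   of the next element" evolves by b' = (1 - q_i) / 2 - q_i b, and the potential
   b ^ 2 yields E D <= sum_i (1 - q_i) / (1 + q_i) + O(1)
   = sum_i tanh (m p_i / 2) + O(1), with equality up to O(1) when p is uniform.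
   Strict concavity of tanh then makes E D drop by at least of the order of
   m ^ 3 eps ^ 2 / n ^ 2 when p is eps-far from uniform.  Adding a sample
   changes D by at most 2, so both the standard deviation of D and the cost of
   passing back to exactly m samples are O(sqrt m), which is beaten by the gap
   as soon as m is a large multiple of (n / eps) ^ (4 / 5). *)

Require Import Defs.
From HB Require Import structures.
From mathcomp Require Import all_boot all_order all_algebra.
From mathcomp Require Import boolp classical_sets functions interval_inference.
From mathcomp Require Import reals topology normedtype sequences derive realfun exp.
From mathcomp Require Import ring lra.

Set Implicit Arguments.
Unset Strict Implicit.
Unset Printing Implicit Defensive.

Import Order.TTheory GRing.Theory Num.Theory numFieldNormedType.Exports.
Local Open Scope ring_scope.

(** * Elementary bounds on the hyperbolic tangent and its concavity *)

Section HyperbolicTangent.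
Variable R : realType.
Implicit Types x y d l : R.

Lemma series_exp_coeff_le x n : 0 <= x -> series (exp_coeff x) n <= expR x.
Proof.
move=> x0; apply: nondecreasing_cvgn_le; last exact: is_cvg_series_exp_coeff.
apply/nondecreasing_seqP => k; rewrite /series /= big_nat_recr //= lerDl.
by rewrite /exp_coeff /= divr_ge0 ?exprn_ge0 ?ler0n.
Qed.

Definition tanh x : R := (1 - expR (- (2 * x))) / (1 + expR (- (2 * x))).

Let e_gt0 x : 0 < expR (- (2 * x)). Proof. exact: expR_gt0. Qed.

Lemma tanh_expR l : (1 - expR (- l)) / (1 + expR (- l)) = tanh (l / 2).
Proof. by rewrite /tanh (_ : 2 * (l / 2) = l) //; field. Qed.

Lemma tanhN x : tanh (- x) = - tanh x.
Proof.
rewrite /tanh mulrN opprK; have p := e_gt0 x.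
have -> : expR (2 * x) = (expR (- (2 * x)))^-1 by rewrite expRN invrK.
field; apply/andP; split; apply: lt0r_neq0; lra.
Qed.

Lemma tanhD x d : tanh (x + d) = (tanh x + tanh d) / (1 + tanh x * tanh d).
Proof.
rewrite /tanh mulrDr opprD expRD.
have := e_gt0 x; have := e_gt0 d.
move: (expR _) (expR (- (2 * x))) => b a b0 a0.
have ab0 : 0 < a * b by rewrite mulr_gt0.
field; repeat (apply/andP; split); apply: lt0r_neq0; nra.
Qed.

Lemma tanh_ge0 x : 0 <= x -> 0 <= tanh x.
Proof.
move=> x0; have := e_gt0 x; rewrite /tanh => p.
rewrite divr_ge0 ?subr_ge0 ?expR_le1 ?oppr_le0 ?mulr_ge0 //; lra.
Qed.

Lemma tanh_le1 x : tanh x <= 1.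
Proof.
have := e_gt0 x; rewrite /tanh => p.
by rewrite ler_pdivrMr; lra.
Qed.

Lemma tanh_le x : 0 <= x -> tanh x <= x.
Proof.
move=> x0; rewrite /tanh ler_pdivrMr; last by have := e_gt0 x; lra.
(* After clearing the denominator, [tanh x <= x] becomes [f 0 <= f x]. *)
pose f y := (1 + y) * expR (- (2 * y)) + y.
have df y : is_derive y 1 f (1 - (1 + 2 * y) * expR (- (2 * y))).
  apply: is_derive_eq; rewrite /GRing.scale /=; ring.
have : f 0 <= f x.
  apply: (@ger0_derive1_le_cc _ f 0 x) => //.
  - move=> y; rewrite in_itv /= => /andP[y0 _].
    rewrite derive1E (@derive_val _ _ _ _ _ _ _ (df y)) subr_ge0.
    by rewrite expRN ler_pdivrMr ?expR_gt0 // mul1r expR_ge1Dx.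
  - apply: derivable_within_continuous => y _.
    by have [] := df y.
  - by rewrite in_itv /= lexx.
  - by rewrite in_itv /= lexx x0.
rewrite /f mulr0 oppr0 expR0; lra.
Qed.

Lemma tanh_ge x : 0 <= x -> x <= 2^-1 -> x - x ^+ 3 / 2 <= tanh x.
Proof.
move=> x0 xh; rewrite /tanh ler_pdivlMr; last by have := e_gt0 x; lra.
have x20 : 0 <= 2 * x by lra.
have H : 1 + 2 * x + 2 * x ^+ 2 + 4 / 3 * x ^+ 3 <= expR (2 * x).
  apply: le_trans (series_exp_coeff_le 4 x20).
  rewrite /series /= !big_nat_recr //= big_nil /exp_coeff /= !factS fact0 !natrM.
  lra.
have e0 := expR_gt0 (2 * x); rewrite expRN.
move: (expR _) H e0 => E H' e0.
have -> : (x - x ^+ 3 / 2) * (1 + E^-1) = (x - x ^+ 3 / 2) * (E + 1) / E.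
  by field; rewrite gt_eqF.
have -> : 1 - E^-1 = (E - 1) / E by field; rewrite gt_eqF.
rewrite ler_pM2r ?invr_gt0 //.
have p : 0 < 1 - x + x ^+ 3 / 2 by have := exprn_ge0 3 x0; lra.
have : 0 <= (1 - x + x ^+ 3 / 2) * (E - (1 + 2 * x + 2 * x ^+ 2 + 4 / 3 * x ^+ 3)).
  by rewrite mulr_ge0 ?subr_ge0 // ltW.
have : 0 <= x ^+ 3 * (1 / 3 - x / 3 + x ^+ 2 + 2 / 3 * x ^+ 3).
  rewrite mulr_ge0 ?exprn_ge0 // addr_ge0 ?mulr_ge0 ?exprn_ge0 //.
  by have := exprn_ge0 2 x0; lra.
lra.
Qed.

(** Concavity from the addition formula: with [a = tanh x] and [t = tanh h], the increment over a
    step [h] is [(1 - a^2) t / (1 + a t)], and [t <= h]. *)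
Lemma tanh_tangent x y : 0 <= x -> x <= y ->
  tanh y <= tanh x + (1 - tanh x ^+ 2) * (y - x).
Proof.
move=> x0 xy; have d0 : 0 <= y - x by rewrite subr_ge0.
have -> : tanh y = tanh (x + (y - x)) by congr tanh; ring.
rewrite tanhD; have := tanh_ge0 d0; have := tanh_le d0; have := tanh_ge0 x0.
have := tanh_le1 x; move: (y - x) (tanh (y - x)) (tanh x) => h t a a1 a0 th t0.
have at0 : 0 <= a * t by rewrite mulr_ge0.
rewrite ler_pdivrMr; last lra.
have A0 : 0 <= 1 - a ^+ 2 by nra.
have : 0 <= (1 - a ^+ 2) * (h - t) by rewrite mulr_ge0 // subr_ge0.
have : 0 <= (1 - a ^+ 2) * h * (a * t) by rewrite !mulr_ge0 // (le_trans t0).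
nra.
Qed.

(** Quantitative strict concavity: for small [x] the second derivative of tanh is about [-2 x], so
    moving left by [h] loses of the order of [x h^2] against the tangent. *)
Lemma tanh_tangent_strong x y : 0 <= y -> y <= x -> x <= 8^-1 ->
  tanh y <= tanh x + (1 - tanh x ^+ 2) * (y - x) - x * (x - y) ^+ 2 / 5.
Proof.
move=> y0 yx x8; have d0 : 0 <= x - y by rewrite subr_ge0.
have x0 : 0 <= x by exact: le_trans yx.
have -> : tanh y = tanh (x + - (x - y)) by congr tanh; ring.
rewrite tanhD tanhN.
have xl : x <= 2^-1 by lra.
have dl : x - y <= 2^-1 by lra.
have := tanh_le d0; have := tanh_ge d0 dl; have := tanh_ge x0 xl.
have := tanh_le x0; have := tanh_ge0 x0; have := tanh_ge0 d0.
have dx : x - y <= x by lra.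
rewrite (_ : y - x = - (x - y)); last by ring.
clear dl; move: (x - y) d0 dx (tanh (x - y)) (tanh x) => h h0 hx t a t0 a0 ax la lt th.
have x2 : x ^+ 2 <= 1 / 64 by nra.
have a2 : a ^+ 2 <= 1 / 64 by nra.
have h2 : h ^+ 2 <= 1 / 64 by nra.
have at1 : a * t <= 1 / 64 by nra.
have A0 : 0 <= 1 - a ^+ 2 by lra.
have a9 : 9 / 10 * x <= a by nra.
have t9 : 9 / 10 * h <= t by nra.
have tt : 8 / 10 * h ^+ 2 <= t ^+ 2 by nra.
have att : 72 / 100 * x * h ^+ 2 <= a * t ^+ 2.
  have -> : 72 / 100 * x * h ^+ 2 = (9 / 10 * x) * (8 / 10 * h ^+ 2) by field.
  by rewrite ler_pM ?mulr_ge0 ?sqr_ge0 //; lra.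
have h3 : h ^+ 3 / 2 <= x * h ^+ 2 / 2.
  by rewrite ler_pM2r ?invr_gt0 // exprS ler_wpM2r ?sqr_ge0.
(* Here [1 / (1 - a t) >= 1 + a t], and [a t^2 >= 0.72 x h^2] outweighs the loss
   [h^3 / 2 <= x h^2 / 2] in [t >= h - h^3 / 2]. *)
have key : h + 22 / 100 * (x * h ^+ 2) <= t / (1 - a * t).
  rewrite ler_pdivlMr; last lra.
  have : (t + a * t ^+ 2) * (1 - a * t) <= t.
    have : 0 <= a ^+ 2 * t ^+ 3 by rewrite mulr_ge0 ?exprn_ge0.
    lra.
  apply: le_trans; rewrite ler_wpM2r; lra.
have -> : (a - t) / (1 + a * - t) = a - (1 - a ^+ 2) * (t / (1 - a * t)).
  by field; apply: lt0r_neq0; lra.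
have xh0 : 0 <= x * h ^+ 2 by rewrite mulr_ge0 ?sqr_ge0.
have := ler_wpM2l A0 key.
have : 63 / 64 * (x * h ^+ 2) <= (1 - a ^+ 2) * (x * h ^+ 2).
  by rewrite ler_wpM2r //; lra.
lra.
Qed.
End HyperbolicTangent.

(** * Expectations over independent samples, variance and Chebyshev *)

Section Expectation.
Variables (R : realType) (T : finType) (p : fdist R T).
Implicit Types (f g : seq T -> R) (s : seq T).

(** Recursion on the first draw over plain sequences, so that samples can be added one at a time;
    [sum_samp] ties it to the sum over tuples. *)
Fixpoint expect m f : R :=
  if m is m'.+1 then \sum_x p x * expect m' (fun s => f (x :: s)) else f [::].

Lemma eq_expect m f g : f =1 g -> expect m f = expect m g.
Proof.
elim: m f g => [|m IH] f g fg /=; first exact: fg.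
by apply: eq_bigr => x _; congr (_ * _); apply: IH => s.
Qed.

Lemma sum_samp m f : \sum_(s : m.-tuple T) samp p s * f s = expect m f.
Proof.
elim: m f => [|m IH] f /=.
  rewrite (bigD1 [tuple]) //= big1 => [|s /eqP[]]; last by rewrite (tuple0 s).
  by rewrite /samp big_ord0 mul1r addr0.
rewrite [RHS](eq_bigr (fun x => \sum_(s : m.-tuple T) p x * (samp p s * f (x :: s)))).
  2: by move=> x _; rewrite -IH mulr_sumr.
rewrite pair_bigA /=.
rewrite (reindex (fun u : T * m.-tuple T => [tuple of u.1 :: u.2])) /=.
  apply: eq_bigr => -[x s] _ /=; rewrite mulrA; congr (_ * _).
  rewrite /samp big_ord_recl tnth0; congr (_ * _).
  by apply: eq_bigr => i _; rewrite tnthS.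
exists (fun t : m.+1.-tuple T => (thead t, [tuple of behead t])) => [[x s]|t] _ /=.
  by congr pair; apply/val_inj.
by rewrite -tuple_eta.
Qed.

Lemma expectD m f g :
  expect m (fun s => f s + g s) = expect m f + expect m g.
Proof.
elim: m f g => [|m IH] f g //=; rewrite -big_split /=.
by apply: eq_bigr => x _; rewrite IH mulrDr.
Qed.

Lemma expectZ m c f : expect m (fun s => c * f s) = c * expect m f.
Proof.
elim: m f => [|m IH] f //=; rewrite mulr_sumr.
by apply: eq_bigr => x _; rewrite IH mulrCA.
Qed.

Lemma expect_cst m c : expect m (fun=> c) = c.
Proof. by elim: m => [|m IH] //=; rewrite IH -mulr_suml pmf_sum1 mul1r. Qed.

Lemma ler_expect m f g : (forall s, f s <= g s) -> expect m f <= expect m g.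
Proof.
elim: m f g => [|m IH] f g fg /=; first exact: fg.
by apply: ler_sum => x _; rewrite ler_wpM2l ?pmf_ge0 // IH.
Qed.

Lemma ler_norm_expect m f : `|expect m f| <= expect m (fun s => `|f s|).
Proof.
rewrite ler_norml -[- _]mulN1r -expectZ; apply/andP; split; apply: ler_expect => s.
  by rewrite mulN1r lerNl -normrN ler_norm.
exact: ler_norm.
Qed.

Lemma expectB m f g :
  expect m (fun s => f s - g s) = expect m f - expect m g.
Proof.
rewrite -[- expect m g]mulN1r -expectZ -expectD.
by apply: eq_expect => s; rewrite mulN1r.
Qed.

(* Exposing the samples one at a time, the increments of the Doob martingale
   are orthogonal and bounded by [c]. *)
Lemma variance_bounded_differences m f (c : R) :
  (forall s1 x y s2, `|f (s1 ++ x :: s2) - f (s1 ++ y :: s2)| <= c) ->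
  expect m (fun s => (f s - expect m f) ^+ 2) <= m%:R * c ^+ 2.
Proof.
elim: m f => [|m IH] f Hf /=; first by rewrite subrr expr0n mul0r.
pose g x := expect m (fun s => f (x :: s)).
pose mu := \sum_x p x * g x.
change (\sum_x p x * expect m (fun s => (f (x :: s) - mu) ^+ 2) <= m.+1%:R * c ^+ 2).
have Hg x : expect m (fun s => (f (x :: s) - mu) ^+ 2) <= m.+1%:R * c ^+ 2.
  have -> : expect m (fun s => (f (x :: s) - mu) ^+ 2)
      = expect m (fun s => (f (x :: s) - g x) ^+ 2) + (g x - mu) ^+ 2.
    rewrite (@eq_expect _ _ (fun s => (f (x :: s) - g x) ^+ 2
      + (2 * (g x - mu) * (f (x :: s) - g x) + (g x - mu) ^+ 2))); last first.
      by move=> s; ring.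
    by rewrite !expectD expectZ expectB !expect_cst subrr mulr0 add0r.
  rewrite -natr1 mulrDl mul1r lerD //.
    by apply: IH => s1 y z s2; apply: (Hf (x :: s1)).
  have gc : `|g x - mu| <= c.
    have -> : g x - mu = \sum_y p y * (g x - g y).
      rewrite (eq_bigr (fun y => p y * g x - p y * g y)).
        by rewrite sumrB -mulr_suml pmf_sum1 mul1r.
      by move=> y _; rewrite mulrBr.
    rewrite (le_trans (ler_norm_sum _ _ _)) //.
    rewrite -[leRHS]mul1r -(pmf_sum1 p) mulr_suml; apply: ler_sum => y _.
    rewrite normrM ger0_norm ?pmf_ge0 // ler_wpM2l ?pmf_ge0 //.
    rewrite /g -expectB (le_trans (ler_norm_expect _ _)) //.
    rewrite -[leRHS](expect_cst m); apply: ler_expect => s.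
    exact: (Hf [::]).
  by rewrite -real_normK ?num_real // lerXn2r ?nnegrE // (le_trans _ gc).
rewrite -[leRHS]mul1r -[X in X * _](pmf_sum1 p) mulr_suml.
by apply: ler_sum => x _; rewrite ler_wpM2l ?pmf_ge0 ?Hg.
Qed.

Lemma chebyshev m f (v r : R) : 0 < r ->
  expect m (fun s => (f s - expect m f) ^+ 2) <= v ->
  expect m (fun s => (r <= `|f s - expect m f|)%R%:R) <= v / r ^+ 2.
Proof.
move=> r0 Hv; rewrite ler_pdivlMr ?exprn_gt0 //; apply: le_trans Hv.
rewrite mulrC -expectZ; apply: ler_expect => s.
case: (boolP (r <= _)) => h; last by rewrite mulr0 sqr_ge0.
rewrite mulr1 -[leRHS]real_normK ?num_real // lerXn2r ?nnegrE ?normr_ge0 //.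
exact: ltW.
Qed.

End Expectation.

(** * Counting bit changes by a multilinear recursion *)

Section AlternationCount.
Variable R : realType.
Implicit Types (b q : R) (l : seq R) (s t : bitseq).

(* [l] lists, element by element, whether the element is absent from the sample
   (1) or present (0); [b] is 1/2 if the last bit seen so far differs from the
   parity of the next element, and -1/2 if they agree.  Being multilinear in
   the entries of [l], the same expression evaluates the expectation when
   presences are independent. *)
Fixpoint alternations b l : R :=
  if l is z :: l' then
    (1 - z) * (2^-1 + b) + alternations ((1 - z) / 2 - z * b) l'
  else 0.

Lemma alternations_affine b l : alternations b l =
  alternations 0 l + b * (alternations 1 l - alternations 0 l).
Proof.
elim: l b => [|z l IH] b /=; first by ring.
rewrite (IH (_ - z * b)) (IH (_ - z * 0)) (IH (_ - z * 1)); ring.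
Qed.

(** One step turns the slope [u] of the tail into [(1 - z) - z * u], a convex combination of 1 and
    [- u]. *)
Lemma alternations_slope l : all (fun z => 0 <= z <= 1) l ->
  `|alternations 1 l - alternations 0 l| <= 1.
Proof.
elim: l => [|z l IH] /=; first by rewrite subrr normr0.
case/andP => /andP[z0 z1] /IH.
rewrite (alternations_affine (_ - z * 0)) (alternations_affine (_ - z * 1)).
rewrite !ler_norml; move: (alternations 1 l) (alternations 0 l) => u v.
move=> /andP[h1 h2]; nra.
Qed.

Lemma alternations_lipschitz b b' l : all (fun z => 0 <= z <= 1) l ->
  `|alternations b l - alternations b' l| <= `|b - b'|.
Proof.
move/alternations_slope => h.
rewrite alternations_affine (alternations_affine b').
rewrite [X in `|X|](_ : _ =
  (b - b') * (alternations 1 l - alternations 0 l)); last by ring.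
by rewrite normrM ler_piMr.
Qed.

(* [b ^+ 2] is the potential: one step gains [(1 - q) / (1 + q)] minus the
   square of the distance from [b] to the fixed point [(1 - q) / (2 * (1 + q))]
   of the recursion, up to a factor. *)
Lemma alternations_le b l : all (fun q => 0 <= q <= 1) l ->
  alternations b l <= \sum_(q <- l) (1 - q) / (1 + q) + b ^+ 2.
Proof.
elim: l b => [|q l IH] b /=; first by rewrite big_nil add0r sqr_ge0.
case/andP => /andP[q0 q1] /IH {}IH; rewrite big_cons.
have := IH ((1 - q) / 2 - q * b); move: (\sum_(_ <- _) _) (alternations _ _) => S G h.
suff : (1 - q) * (2^-1 + b) + ((1 - q) / 2 - q * b) ^+ 2 <= (1 - q) / (1 + q) + b ^+ 2.
  lra.
have q10 : 0 < 1 + q by lra.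
rewrite -subr_ge0 [leRHS](_ : _ = (1 - q) * (1 + q) * (b - (1 - q) / (2 * (1 + q))) ^+ 2).
  by rewrite mulr_ge0 ?sqr_ge0 // mulr_ge0 //; lra.
by field; rewrite gt_eqF.
Qed.

(** The linear potential [T (b - 1/2)] with [T = (1 - q) / (1 + q)] makes every step an equality;
    only the end of the list loses, where [b <= 1/2]. *)
Lemma alternations_nseq_ge k b q : 0 <= q <= 1 -> - 2^-1 <= b <= 2^-1 ->
  k%:R * ((1 - q) / (1 + q)) + (1 - q) / (1 + q) * (b - 2^-1)
    <= alternations b (nseq k q).
Proof.
move=> /andP[q0 q1]; have q10 : 0 < 1 + q by lra.
have T0 : 0 <= (1 - q) / (1 + q) by rewrite divr_ge0 //; lra.
elim: k b => [|k IH] b /andP[b1 b2] /=.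
  by rewrite mul0r add0r mulr_ge0_le0 //; lra.
apply: le_trans (_ : (1 - q) * (2^-1 + b) + (k%:R * ((1 - q) / (1 + q)) +
  (1 - q) / (1 + q) * ((1 - q) / 2 - q * b - 2^-1)) <= _); last first.
  by rewrite lerD2l IH //; apply/andP; split; nra.
rewrite -natr1 le_eqVlt; apply/orP; left; apply/eqP.
by field; rewrite gt_eqF.
Qed.

Fixpoint bit_changes (a : bool) s : nat :=
  if s is c :: s' then (a != c) + bit_changes c s' else 0.

(** Further copies of the current element change no bit, so only the set of elements seen
    matters. *)
Lemma bit_changes_skip x (u : seq nat) : sorted leq u -> all (leq x) u ->
  bit_changes (odd x) (map odd u) =
  bit_changes (odd x) (map odd [seq y <- u | y != x]).
Proof.
elim: u => [|y u IH] //= su /andP[xy xu].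
have [->|yx] /= := eqVneq y x.
  by rewrite eqxx add0n IH // (path_sorted su).
rewrite (_ : [seq z <- u | z != x] = u) //.
apply/all_filterP/allP => z zu; have := order_path_min leq_trans su.
by move/allP/(_ _ zu) => yz; apply: contraNneq yx => zx; rewrite eqn_leq xy -zx yz.
Qed.

(** After the elements up to [i], the last bit [a] differs from the parity of [i + 1] exactly when
    [a == odd i], which fixes the initial bias. *)
Lemma bit_changes_alternations r i (a : bool) (u : seq nat) :
  sorted leq u -> all (fun x => i < x <= i + r)%N u ->
  (bit_changes a (map odd u))%:R =
  alternations (if a == odd i then 2^-1 else - 2^-1)
    [seq (y \notin u)%:R | y <- iota i.+1 r].
Proof.
elim: r i a u => [|r IH] i a u su hu.
  rewrite addn0 in hu; case: u su hu => //= x u _ /andP[/andP[h1 h2] _].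
  by move: (leq_trans h1 h2); rewrite ltnn.
rewrite [iota _ _]/= map_cons [RHS]/=.
have su' : sorted leq [seq y <- u | y != i.+1] by apply: sorted_filter => //; exact: leq_trans.
have hu' : all (fun x => i.+1 < x <= i.+1 + r)%N [seq y <- u | y != i.+1].
  apply/allP => x; rewrite mem_filter => /andP[xi xu].
  by move/allP: hu => /(_ _ xu); rewrite addSnnS (ltn_neqAle i.+1) eq_sym xi.
have mem' : [seq (y \notin u)%:R | y <- iota i.+2 r]
    = [seq (y \notin [seq y <- u | y != i.+1])%:R | y <- iota i.+2 r] :> seq R.
  apply/eq_in_map => y; rewrite mem_iota => /andP[h _].
  by rewrite mem_filter gtn_eqF.
rewrite mem'.
have [iu|iu] /= := boolP (i.+1 \in u).
  (* If [i + 1] occurs it is the smallest element, hence the head, and its further copies may be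
     filtered out. *)
  case: u su hu iu su' hu' mem' => // x u su hu iu su' hu' mem'.
  have xi : x = i.+1.
    apply/eqP; rewrite eqn_leq; move: (hu) => /= /andP[/andP[-> _] _].
    rewrite andbT; move: iu; rewrite inE => /orP[/eqP -> //|].
    by move=> iu; have /allP/(_ _ iu) := order_path_min leq_trans su.
  subst x; rewrite (_ : bit_changes a (map odd (i.+1 :: u)) =
    ((a != odd i.+1) + bit_changes (odd i.+1) (map odd u))%N) //.
  rewrite bit_changes_skip ?(path_sorted su) //; last first.
    exact: order_path_min leq_trans su.
  rewrite natrD; rewrite /= eqxx /= in su' hu' *.
  rewrite (IH i.+1) // eqxx; congr (_ + alternations _ _).
    case: a; case: (odd i) => /=;
      by rewrite ?addNr ?subr0 ?mulr0 ?mul1r //; field.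
  by rewrite mul0r subr0 subr0 mul1r.
rewrite subrr mul0r add0r mul0r sub0r mul1r.
have -> : [seq y <- u | y != i.+1] = u.
  by apply/all_filterP/allP => y yu; apply: contraNneq iu => <-.
rewrite (IH i.+1) ?mul0r //; last first.
  apply/allP => y yu; move/allP: (hu) => /(_ _ yu); rewrite addSnnS.
  by rewrite (ltn_neqAle i.+1) eq_sym (contraNneq _ iu) // => <-.
by congr alternations; rewrite [odd _]/=; case: a; case: (odd i); rewrite /= ?opprK; ring.
Qed.

End AlternationCount.

(** * Independence of absences under a Poisson number of samples *)

Section Poissonization.
Local Open Scope classical_set_scope.
Local Open Scope ring_scope.
Variables (R : realType) (T : finType) (p : fdist R T).
Implicit Types (Phi : (T -> R) -> R) (s : seq T) (M : R).

Definition absent s (i : T) : R := (i \notin s)%:R.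

Lemma expect_prod_absent m (J : seq T) : uniq J ->
  expect p m (fun s => \prod_(i <- J) absent s i) = (1 - \sum_(i <- J) p i) ^+ m.
Proof.
move=> uJ; elim: m => [|m IH] /=; first by rewrite big1 // /absent => i _; rewrite in_nil.
rewrite exprS -IH; set E := expect _ _ _.
have -> : \sum_x p x * expect p m (fun s => \prod_(i <- J) absent (x :: s) i)
    = \sum_x (p x - (if x \in J then p x else 0)) * E.
  apply: eq_bigr => x _; case: ifP => xJ.
    rewrite subrr mul0r -[RHS](mulr0 (p x)); congr (_ * _).
    rewrite -[RHS](expect_cst p m 0); apply: eq_expect => s.
    by rewrite (big_rem x) //= /absent mem_head mul0r.
  rewrite subr0; congr (_ * _); apply: eq_expect => s.
  apply: eq_big_seq => i iJ; rewrite /absent inE negb_or.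
  by rewrite (_ : i != x) //; apply: contraFneq xJ => <-.
by rewrite -mulr_suml sumrB pmf_sum1 -big_mkcond /= -big_uniq.
Qed.

(** Without the factor [expR (- M)], which appears in limits as [expR M] instead. *)
Definition poisson_weight M j : R := M ^+ j / j`!%:R.

(** With a Poisson number of samples, the mean of [Phi] is its value at the absence probabilities,
    as if absences were independent. The absence factors over [J], disjoint from the variables [l]
    of [Phi], make the notion stable under multiplication by a new variable. *)
Definition poissonizable M (l : seq T) Phi :=
  forall J : seq T, uniq J -> {in J, forall i, i \notin l} ->
  (fun n => \sum_(0 <= j < n) poisson_weight M j *
     expect p j (fun s => Phi (absent s) * \prod_(i <- J) absent s i))
  @ \oo --> expR M * (Phi (fun i => expR (- (M * p i))) *
     \prod_(i <- J) expR (- (M * p i))).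

(** The weighted powers of [1 - sum p] sum to an exponential, which factors over [J]: this is the
    independence of absences. *)
Lemma poissonizable_cst M l c : poissonizable M l (fun=> c).
Proof.
move=> J uJ _.
have -> : expR M * (c * \prod_(i <- J) expR (- (M * p i)))
    = c * expR (M * (1 - \sum_(i <- J) p i)).
  by rewrite mulrCA -expR_sum -expRD mulrBr mulr1 sumrN mulr_sumr.
rewrite (_ : (fun n => _) =
    (fun n => c * series (exp_coeff (M * (1 - \sum_(i <- J) p i))) n)).
  apply: cvgM; [exact: cvg_cst | exact: is_cvg_series_exp_coeff].
apply/funext => n; rewrite /series /= mulr_sumr; apply: eq_bigr => j _.
rewrite expectZ expect_prod_absent // /poisson_weight /exp_coeff /= exprMn; ring.
Qed.

Lemma poissonizableD M l Phi Psi : poissonizable M l Phi ->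
  poissonizable M l Psi -> poissonizable M l (fun z => Phi z + Psi z).
Proof.
move=> hP hQ J uJ Jl; rewrite mulrDl mulrDr.
apply: cvg_trans (cvgD (hP J uJ Jl) (hQ J uJ Jl)); apply: near_eq_cvg.
apply: nearW => n; rewrite fctE -big_split /=; apply: eq_bigr => j _.
by rewrite -mulrDr -expectD; congr (_ * _); apply: eq_expect => s; rewrite mulrDl.
Qed.

Lemma poissonizableZ M l c Phi : poissonizable M l Phi ->
  poissonizable M l (fun z => c * Phi z).
Proof.
move=> hP J uJ Jl; rewrite -mulrA mulrCA.
apply: cvg_trans (cvgM (cvg_cst c) (hP J uJ Jl)); apply: near_eq_cvg.
apply: nearW => n; rewrite /= mulr_sumr; apply: eq_bigr => j _.
by rewrite mulrCA -(expectZ p j c); congr (_ * _); apply: eq_expect => s; rewrite mulrA.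
Qed.

(** The factor [z a] is moved into [J]. *)
Lemma poissonizableM M l a Phi : a \notin l -> poissonizable M l Phi ->
  poissonizable M (a :: l) (fun z => z a * Phi z).
Proof.
move=> al hP J uJ Jl.
have aJ : a \notin J by apply/negP => /Jl; rewrite mem_head.
have := hP (a :: J); rewrite /= aJ uJ big_cons => /(_ isT).
have aJl : {in a :: J, forall i, i \notin l}.
  move=> i; rewrite inE => /orP[/eqP -> //|/Jl].
  by rewrite inE negb_or => /andP[].
move=> /(_ aJl); set y := Phi _; set e := expR (- _).
rewrite [y * (e * _)]mulrCA [e * (y * _)]mulrA => H.
apply: cvg_trans H; apply: near_eq_cvg; apply: nearW => n /=.
apply: eq_bigr => j _; congr (_ * _).
by apply: eq_expect => s; rewrite big_cons mulrCA mulrA.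
Qed.

Lemma poissonizable_sub M l a Phi : poissonizable M l Phi ->
  poissonizable M (a :: l) Phi.
Proof.
by move=> hP J uJ Jl; apply: hP => // i /Jl; rewrite inE negb_or => /andP[].
Qed.

Lemma poissonizable_alternations M b (l : seq T) : uniq l ->
  poissonizable M l (fun z => alternations b (map z l)).
Proof.
elim: l b => [|a l IH] b; first by move=> _; exact: poissonizable_cst.
move=> /= /andP[al /IH {}IH].
pose A b (z : T -> R) := alternations b (map z l).
(* Expansion of one step: [z a] multiplies only functions of the later elements, so the closure
   rules apply. *)
rewrite (_ : (fun z => _) = fun z =>
  (2^-1 + b) + (A 0 z + (2^-1 * (A 1 z + -1 * A 0 z) +
   (z a * (- (2^-1 + b)) + z a * ((2^-1 + b) * (-1 * A 1 z + A 0 z)))))).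
  have ext Phi : poissonizable M l Phi -> poissonizable M (a :: l) Phi.
    exact: poissonizable_sub.
  have hA c : poissonizable M l (A c) := IH c.
  apply: poissonizableD; first exact: poissonizable_cst.
  apply: poissonizableD; first exact: ext.
  apply: poissonizableD.
    apply/poissonizableZ/ext/poissonizableD => //; exact: poissonizableZ.
  apply: poissonizableD; apply: poissonizableM => //.
    exact: poissonizable_cst.
  by apply/poissonizableZ/poissonizableD => //; exact: poissonizableZ.
apply/funext => z; rewrite /A /= (alternations_affine (_ - _)); ring.
Qed.

End Poissonization.

(** * Passing from a Poisson number of samples back to a fixed one *)

Section FixedSampleSize.
Local Open Scope classical_set_scope.
Local Open Scope ring_scope.
Variables (R : realType) (T : finType) (p : fdist R T).
Implicit Types (s : seq T) (f : seq T -> R).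

Lemma expectS_dist m f (c : R) : (forall x s, `|f (x :: s) - f s| <= c) ->
  `|expect p m.+1 f - expect p m f| <= c.
Proof.
move=> Hf /=.
have -> : \sum_x p x * expect p m (fun s => f (x :: s)) - expect p m f
    = \sum_x p x * expect p m (fun s => f (x :: s) - f s).
  rewrite -[X in _ - X]mul1r -[X in X * expect p m f](pmf_sum1 p) mulr_suml -sumrB.
  by apply: eq_bigr => x _; rewrite expectB mulrBr.
rewrite (le_trans (ler_norm_sum _ _ _)) //.
rewrite -[leRHS]mul1r -(pmf_sum1 p) mulr_suml; apply: ler_sum => x _.
rewrite normrM ger0_norm ?pmf_ge0 // ler_wpM2l ?pmf_ge0 //.
rewrite (le_trans (ler_norm_expect _ _ _)) // -[leRHS](expect_cst p m).
exact: ler_expect.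
Qed.

Lemma expect_dist m j f (c : R) : (forall x s, `|f (x :: s) - f s| <= c) ->
  `|expect p j f - expect p m f| <= c * `|j%:R - m%:R|.
Proof.
move=> Hf; have H d i : `|expect p (i + d) f - expect p i f| <= c * d%:R.
  elim: d => [|d IH]; first by rewrite addn0 subrr normr0 mulr0.
  rewrite addnS -natr1 mulrDr mulr1 addrC.
  have := expectS_dist (i + d) Hf; move: IH.
  rewrite !ler_norml; lra.
case: (leqP m j) => [mj|/ltnW jm].
  by rewrite -{1}(subnKC mj) (le_trans (H _ _)) // natrB // ger0_norm // subr_ge0 ler_nat.
rewrite distrC -{1}(subnKC jm) (le_trans (H _ _)) // natrB // distrC ger0_norm //.
by rewrite subr_ge0 ler_nat.
Qed.

(** Truncated Poisson variance in closed form; the boundary term only lowers it once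
    [n + 1 >= M]. *)
Lemma poisson_second_moment (M : R) n :
  \sum_(0 <= j < n.+1) poisson_weight M j * (j%:R - M) ^+ 2
  = M * (series (exp_coeff M) n.+1 - (n.+1%:R - M) * poisson_weight M n).
Proof.
elim: n => [|n IH].
  rewrite /series /= !big_nat1 /poisson_weight /exp_coeff /= expr0 fact0 divr1; ring.
rewrite big_nat_recr //= IH /series /= [in RHS]big_nat_recr //=.
rewrite /exp_coeff /= -/(poisson_weight M n.+1).
have -> : poisson_weight M n.+1 = M / n.+1%:R * poisson_weight M n.
  rewrite /poisson_weight exprS factS natrM; field.
  by rewrite nat1r !pnatr_eq0 -lt0n fact_gt0.
move: (poisson_weight _ _) (\sum_(_ <= _ < _) _) => w S.
by rewrite -[n.+2%:R]natr1; field; rewrite nat1r pnatr_eq0.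
Qed.

(* Poisson (m) concentrates within [sqrt m] of [m]; since changing the number of
   samples by one changes [f] by at most [c], replacing m samples by a Poisson
   number of them costs [O (sqrt m)]. *)
Lemma depoissonization m f (c mu : R) : (0 < m)%N ->
  (forall x s, `|f (x :: s) - f s| <= c) ->
  (fun n => \sum_(0 <= j < n) poisson_weight m%:R j * expect p j f) @ \oo
    --> expR m%:R * mu ->
  `|expect p m f - mu| <= c * Num.sqrt m%:R.
Proof.
move=> m0 Hf cvg_f.
have M0 : 0 < m%:R :> R by rewrite ltr0n.
pose r : R := Num.sqrt m%:R; have r0 : 0 < r by rewrite sqrtr_gt0.
have rr : r ^+ 2 = m%:R by rewrite sqr_sqrtr // ltW.
have c0 : 0 <= c.
  have [x _] : exists x : T, true.
    case: (pickP T) => [x _|T0]; first by exists x.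
    by have := pmf_sum1 p; rewrite big_pred0 // => /esym/eqP; rewrite oner_eq0.
  exact: le_trans (Hf x [::]).
pose w : nat -> R := poisson_weight m%:R.
have w0 j : 0 <= w j by rewrite /w divr_ge0 // exprn_ge0.
pose D n := \sum_(0 <= j < n) w j * expect p j f
  - expect p m f * series (exp_coeff m%:R) n.
have cvg_D : D @ \oo --> expR m%:R * mu - expect p m f * expR m%:R.
  apply: cvgB => //; apply: cvgM; first exact: cvg_cst.
  exact: is_cvg_series_exp_coeff.
have bound_D n : (m < n)%N -> `|D n| <= c * r * expR m%:R.
  move=> n0.
  have -> : D n = \sum_(0 <= j < n) w j * (expect p j f - expect p m f).
    rewrite /D /series /= mulr_sumr -sumrB; apply: eq_bigr => j _.
    by rewrite mulrBr [expect p m f * _]mulrC.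
  rewrite (le_trans (ler_norm_sum _ _ _)) //.
  (* With [r = sqrt m], [|j - m| <= r / 2 + (j - m)^2 / (2 r)], so the second moment suffices. *)
  apply: (@le_trans _ _ (\sum_(0 <= j < n)
      (c * r / 2 * w j + c / (2 * r) * (w j * (j%:R - m%:R) ^+ 2)))).
    apply: ler_sum => j _; rewrite normrM ger0_norm //.
    rewrite [leRHS](_ : _ = w j * (c * (r / 2 + (j%:R - m%:R) ^+ 2 / (2 * r)))); last first.
      by field; rewrite gt_eqF.
    rewrite ler_wpM2l // (le_trans (expect_dist _ _ Hf)) // ler_wpM2l //.
    rewrite -[X in _ + X / _]real_normK ?num_real //.
    move: `|_| => d; rewrite -subr_ge0 [leRHS](_ : _ = (d - r) ^+ 2 / (2 * r)); last first.
      by field; rewrite gt_eqF.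
    by rewrite divr_ge0 ?sqr_ge0 // mulr_ge0 // ltW.
  rewrite big_split /= -!mulr_sumr.
  case: n n0 => // n n0; rewrite poisson_second_moment.
  rewrite -[X in _ * X + _]/(series (exp_coeff m%:R) n.+1) -/w.
  have := series_exp_coeff_le n.+1 (ltW M0); move: (series _ _) => S Sle.
  set Y := S - _ * _; have YS : Y <= S.
    by rewrite /Y gerBl mulr_ge0 // subr_ge0 ler_nat ltnW.
  have -> : c / (2 * r) * (m%:R * Y) = c * r / 2 * Y.
    by rewrite -rr; field; rewrite gt_eqF.
  have cr0 : 0 <= c * r by rewrite mulr_ge0 // ltW.
  apply: (@le_trans _ _ (c * r * S)); last by rewrite ler_wpM2l.
  have := ler_wpM2l cr0 YS; lra.
have cvg_nD : (fun n => `|D n|) @ \oo --> `|expR m%:R * mu - expect p m f * expR m%:R|.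
  exact: cvg_norm cvg_D.
have near_D : \forall n \near \oo, `|D n| <= c * r * expR m%:R.
  near=> n; apply: bound_D; near: n; exact: nbhs_infty_gt.
have := limr_le (cvgP _ cvg_nD) near_D; rewrite (cvg_lim _ cvg_nD) //.
rewrite [expect p m f * _]mulrC -mulrBr normrM ger0_norm ?expR_ge0 // [leRHS]mulrC.
by rewrite ler_pM2l ?expR_gt0 // (distrC mu); apply.
Unshelve. all: by end_near. Qed.

End FixedSampleSize.

(** * Loss in the sum of tanh caused by distance from uniform *)

Section UniformityGap.
Variables (R : realType) (k : nat) (p : fdist R 'I_k).

Lemma sqr_sum_le (F : 'I_k -> R) :
  (\sum_i F i) ^+ 2 <= k%:R * \sum_i F i ^+ 2.
Proof.
case: (posnP k) => [k0|k0].
  rewrite big1 => [|i _]; last by have := ltn_ord i; rewrite [X in (_ < X)%N]k0.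
  by rewrite expr0n mulr_ge0 // sumr_ge0 // => i _; exact: sqr_ge0.
have k0' : 0 < k%:R :> R by rewrite ltr0n.
set S := \sum_i F i.
have : 0 <= \sum_i (k%:R * F i - S) ^+ 2 by rewrite sumr_ge0 // => i _; exact: sqr_ge0.
rewrite (eq_bigr (fun i => k%:R ^+ 2 * F i ^+ 2 + - (2 * k%:R * S) * F i + S ^+ 2)).
  rewrite !big_split /= sumr_const card_ord -!mulr_sumr -/S -[S ^+ 2 *+ k]mulr_natl.
  rewrite [X in 0 <= X](_ : _ = k%:R * (k%:R * (\sum_i F i ^+ 2) - S ^+ 2)); last by ring.
  by rewrite pmulr_rge0 // subr_ge0.
by move=> i _; ring.
Qed.

(** Tangent bounds at the uniform value [x]: the linear terms cancel, and the elements below [x]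
    give a quadratic gain, bounded below by Cauchy-Schwarz. *)
Lemma sum_tanh_far (M eps : R) : (0 < k)%N -> 0 <= M -> M / (2 * k%:R) <= 8^-1 ->
  0 <= eps -> eps < tv_dist p (@uniform_pmf R 'I_k) ->
  \sum_i tanh (M * p i / 2) <=
    k%:R * tanh (M / (2 * k%:R)) - M ^+ 3 * eps ^+ 2 / (40 * k%:R ^+ 2).
Proof.
move=> k0 M0; have k0' : 0 < k%:R :> R by rewrite ltr0n.
set x := M / (2 * k%:R) => x8 e0 etv.
have x0 : 0 <= x by rewrite divr_ge0 // mulr_ge0 // ltW.
(* [d i] is the positive part of [x - y i]; as the deviations sum to 0, these parts carry half of
   the L1 distance. *)
pose y i := M * p i / 2; pose d i := (`|x - y i| + (x - y i)) / 2.
have y0 i : 0 <= y i by rewrite divr_ge0 // mulr_ge0 // pmf_ge0.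
have sumxy : \sum_i (x - y i) = 0.
  rewrite sumrB sumr_const card_ord -[x *+ k]mulr_natl -mulr_suml -mulr_sumr pmf_sum1.
  by rewrite /x; field; rewrite gt_eqF.
have sumd : \sum_i d i = M / 2 * tv_dist p (@uniform_pmf R 'I_k).
  rewrite -mulr_suml big_split /= sumxy addr0 /tv_dist mulrCA mulr_sumr mulrC; congr (_ * _).
  apply: eq_bigr => i _; rewrite /uniform_pmf card_ord distrC.
  rewrite -[X in X * `|_|]ger0_norm ?divr_ge0 // -normrM; congr (`|_|).
  by rewrite /x /y; field; rewrite gt_eqF.
have step i : tanh (y i) <= tanh x + (1 - tanh x ^+ 2) * - (x - y i) - x / 5 * d i ^+ 2.
  case: (leP x (y i)) => xy.
    have -> : d i = 0 by rewrite /d distrC ger0_norm ?subr_ge0 //; ring.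
    by rewrite expr0n mulr0 subr0 opprB; exact: tanh_tangent.
  have -> : d i = x - y i by rewrite /d ger0_norm ?subr_ge0 1?ltW //; field.
  have := tanh_tangent_strong (y0 i) (ltW xy) x8; rewrite opprB; lra.
apply: (@le_trans _ _ (\sum_i (tanh x + (1 - tanh x ^+ 2) * - (x - y i) - x / 5 * d i ^+ 2))).
  by apply: ler_sum => i _; exact: step.
rewrite sumrB big_split /= sumr_const card_ord -[tanh x *+ k]mulr_natl -!mulr_sumr sumrN sumxy.
rewrite oppr0 mulr0 addr0 lerD2l lerN2.
have := sqr_sum_le d; rewrite sumd; move: (\sum_i _) => S hS.
have te : eps ^+ 2 <= tv_dist p (@uniform_pmf R 'I_k) ^+ 2.
  by rewrite lerXn2r ?nnegrE // ltW // (le_lt_trans e0).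
have : (M / 2) ^+ 2 * eps ^+ 2 <= k%:R * S.
  by apply: le_trans hS; rewrite [leRHS]exprMn ler_wpM2l // sqr_ge0.
move=> h; have := ler_wpM2l x0 h.
rewrite -[x / 5 * S](_ : x * (k%:R * S) / (5 * k%:R) = _); last by field; rewrite gt_eqF.
rewrite ler_pdivlMr ?mulr_gt0 //; apply: le_trans.
rewrite /x le_eqVlt; apply/orP; left; apply/eqP; by field; rewrite gt_eqF.
Qed.

End UniformityGap.

(** * Mean and concentration of the statistic, and the threshold test *)

Section Tester.
Variables (R : realType) (k : nat).
Implicit Types (s : seq 'I_k) (p : fdist R 'I_k).

(** Initial bias 1/2 stands for a leading bit 0, which differs from the parity of the element 1; the
    count of changes thus becomes a function of absences alone. *)
Definition statistic s : R := alternations 2^-1 (map (absent R s) (enum 'I_k)).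

Lemma bit_changes_trace m (s : m.-tuple 'I_k) :
  (bit_changes false (trace (sample_values s)))%:R = statistic s.
Proof.
rewrite /trace /= (@bit_changes_alternations R k 0); first last.
- by apply/allP => x; rewrite mem_sort => /mapP[i _ ->]; rewrite /= add0n ltn_ord.
- exact: (sort_sorted leq_total).
congr alternations; rewrite (iotaDl 1 0).
rewrite -val_enum_ord -!map_comp; apply: eq_map => i /=.
by rewrite /absent mem_sort add1n mem_map // => u v [] /val_inj.
Qed.


(** Only the term at [x] and the bias after it change directly, each by at most 1; the Lipschitz
    bound controls the rest. *)
Lemma alternations_update (T : eqType) (z z' : T -> R) (x : T) l b :
  (forall i, 0 <= z i <= 1) -> (forall i, 0 <= z' i <= 1) ->
  (forall i, i != x -> z i = z' i) -> uniq l -> `|b| <= 2^-1 ->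
  `|alternations b (map z l) - alternations b (map z' l)| <= 2.
Proof.
move=> z01 z'01 zz'; elim: l b => [|a l IH] b /=; first by rewrite subrr normr0.
case/andP => al ul hb; move: (hb); rewrite ler_norml => /andP[b1 b2].
have /andP[za0 za1] := z01 a; have /andP[za'0 za'1] := z'01 a.
have [ax|ax] := eqVneq a x; last first.
  rewrite -(zz' a ax) opprD addrACA subrr add0r IH //.
  by rewrite ler_norml; nra.
have -> : map z' l = map z l.
  by apply/eq_in_map => i il; rewrite zz' //; apply: contraNneq al => ix; rewrite ax -ix.
have hl : all (fun u => 0 <= u <= 1) (map z l).
  by rewrite all_map; apply/allP => i _; exact: z01.
have := @alternations_lipschitz R ((1 - z a) / 2 - z a * b) ((1 - z' a) / 2 - z' a * b) _ hl.
have : `|(1 - z a) / 2 - z a * b - ((1 - z' a) / 2 - z' a * b)| <= 1.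
  by rewrite ler_norml; nra.
move: (alternations _ _) (alternations (_ / 2 - z' a * b) _) => u v h1 h2.
have : `|u - v| <= 1 by exact: le_trans h1.
rewrite !ler_norml; nra.
Qed.

Lemma statistic_cons x s : `|statistic (x :: s) - statistic s| <= 2.
Proof.
have absent01 t i : 0 <= absent R t i <= 1.
  by rewrite /absent; case: (_ \in _); rewrite ?lexx ler01.
apply: (@alternations_update _ _ _ x) => //.
- by move=> i ix; rewrite /absent inE (negPf ix).
- exact: enum_uniq.
- by rewrite ger0_norm // invr_ge0.
Qed.

Lemma statistic_exchange s1 x y s2 :
  `|statistic (s1 ++ x :: s2) - statistic (s1 ++ y :: s2)| <= 4.
Proof.
(* Order is irrelevant, so the exchanged sample may be moved to the front. *)
have perm u : statistic (s1 ++ u :: s2) = statistic (u :: s1 ++ s2).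
  congr alternations; apply: eq_map => i.
  by rewrite /absent !inE !mem_cat !inE orbCA.
rewrite !perm; have := statistic_cons x (s1 ++ s2); have := statistic_cons y (s1 ++ s2).
rewrite !ler_norml; lra.
Qed.

Lemma expect_statistic p m : (0 < m)%N ->
  `|expect p m statistic -
    alternations 2^-1 [seq expR (- (m%:R * p i)) | i <- enum 'I_k]|
  <= 2 * Num.sqrt m%:R.
Proof.
move=> m0; apply: depoissonization => //; first exact: statistic_cons.
have nilP : {in [::], forall i : 'I_k, i \notin enum 'I_k} by [].
have := @poissonizable_alternations R _ p m%:R 2^-1
  (enum 'I_k) (enum_uniq _) [::] isT nilP.
rewrite big_nil mulr1 => H; apply: cvg_trans H.
apply: near_eq_cvg; apply: nearW => n /=; apply: eq_bigr => j _; congr (_ * _).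
by apply: eq_expect => s; rewrite big_nil mulr1.
Qed.

Lemma expect_statistic_uniform p m : (0 < m)%N ->
  (forall x, p x = uniform_pmf R x) ->
  k%:R * tanh (m%:R / (2 * k%:R)) - 2 * Num.sqrt m%:R <= expect p m statistic.
Proof.
move=> m0 pu; have := expect_statistic p m0.
have -> : [seq expR (- (m%:R * p i)) | i <- enum 'I_k]
    = nseq k (expR (- (m%:R / k%:R))).
  rewrite -[in nseq _](size_enum_ord k); elim: (enum 'I_k) => //= i l ->.
  by rewrite pu /uniform_pmf card_ord.
have q01 : 0 <= expR (- (m%:R / k%:R : R)) <= 1.
  by rewrite expR_ge0 expR_le1 oppr_le0 divr_ge0.
have b01 : - 2^-1 <= (2^-1 : R) <= (2^-1 : R).
  by rewrite lexx andbT; lra.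
have := alternations_nseq_ge k q01 b01.
(* At initial bias 1/2 the boundary term vanishes. *)
rewrite subrr mulr0 addr0 tanh_expR.
have -> : m%:R / k%:R / 2 = m%:R / (2 * k%:R) :> R.
  by rewrite -mulrA -invfM [k%:R * 2]mulrC.
by rewrite ler_norml => h /andP[h1 h2]; lra.
Qed.

Lemma expect_statistic_far p m eps : (0 < m)%N -> (0 < k)%N ->
  m%:R / (2 * k%:R) <= 8^-1 :> R ->
  0 <= eps -> eps < tv_dist p (@uniform_pmf R 'I_k) ->
  expect p m statistic <= k%:R * tanh (m%:R / (2 * k%:R))
    - m%:R ^+ 3 * eps ^+ 2 / (40 * k%:R ^+ 2) + 4^-1 + 2 * Num.sqrt m%:R.
Proof.
move=> m0 k0 x8 e0 etv; have := expect_statistic p m0.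
have q01 : all (fun q => 0 <= q <= 1) [seq expR (- (m%:R * p i)) | i <- enum 'I_k].
  rewrite all_map; apply/allP => i _ /=.
  by rewrite expR_ge0 expR_le1 oppr_le0 mulr_ge0 // pmf_ge0.
have := alternations_le 2^-1 q01; rewrite big_map big_enum /=.
under eq_bigr do rewrite tanh_expR.
have := sum_tanh_far k0 (ler0n R m) x8 e0 etv.
rewrite ler_norml => h1 h2 /andP[h3 h4].
(* The initial potential [b^2] accounts for the 1/4. *)
have : (2^-1 : R) ^+ 2 = 4^-1 by field.
lra.
Qed.

(** Accepts when there are many changes, since departure from uniform lowers their mean. *)
Definition tester_accept (theta : R) m (t : m.-tuple bool) : R :=
  (theta <= (bit_changes false t)%:R)%R%:R.

Lemma tester_accept_itv theta m (t : m.-tuple bool) : 0 <= tester_accept theta t <= 1.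
Proof. by rewrite /tester_accept ler0n lern1 leq_b1. Qed.

Definition tester theta m : trace_algorithm R :=
  @TraceAlgorithm R m _ (@tester_accept_itv theta m).

Lemma prob_accepts_tester p theta m : prob_accepts (tester theta m) p =
  expect p m (fun s => (theta <= statistic s)%R%:R).
Proof.
rewrite -sum_samp; apply: eq_bigr => s _.
by rewrite /= /tester_accept bit_changes_trace.
Qed.

Lemma prob_accepts_tester0 p m : prob_accepts (tester 0 m) p = 1.
Proof.
rewrite -[RHS](expect_cst p m) -sum_samp; apply: eq_bigr => s _.
by rewrite /= /tester_accept ler0n.
Qed.

Lemma prob_rejects_tester p theta m : prob_rejects (tester theta m) p =
  expect p m (fun s => 1 - (theta <= statistic s)%R%:R).
Proof.
rewrite -sum_samp; apply: eq_bigr => s _.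
by rewrite /= /tester_accept bit_changes_trace.
Qed.

(** Exchanges cost at most 4, so the variance is at most [16 m], and [16 / 13^2 < 1 / 10]. *)
Lemma statistic_concentration p m : (0 < m)%N ->
  expect p m (fun s =>
    (13 * Num.sqrt m%:R <= `|statistic s - expect p m statistic|)%R%:R) <= 1 / 10.
Proof.
move=> m0; have M0 : 0 < m%:R :> R by rewrite ltr0n.
have r0 : 0 < 13 * Num.sqrt m%:R :> R by rewrite mulr_gt0 // sqrtr_gt0.
apply: le_trans (chebyshev r0 (variance_bounded_differences p m statistic_exchange)) _.
rewrite exprMn sqr_sqrtr ?(ltW M0) // ler_pdivrMr ?mulr_gt0 ?exprn_gt0 //.
by have : 0 < m%:R :> R := M0; lra.
Qed.

(** The 15 is 13 for the fluctuation plus 2 for depoissonization. *)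
Lemma tester_uniform p m theta : (0 < m)%N -> (forall x, p x = uniform_pmf R x) ->
  theta + 15 * Num.sqrt m%:R <= k%:R * tanh (m%:R / (2 * k%:R)) ->
  9 / 10 <= prob_accepts (tester theta m) p.
Proof.
move=> m0 pu th; have E := expect_statistic_uniform m0 pu.
rewrite prob_accepts_tester.
have := statistic_concentration p m0; set B := expect _ _ _ => HB.
have r0 := sqrtr_ge0 (m%:R : R).
apply: (@le_trans _ _ (1 - B)); first lra.
rewrite -[X in X - B](expect_cst p m 1) -expectB; apply: ler_expect => s.
case: (lerP theta (statistic s)) => h.
  by rewrite [leRHS](_ : _ = 1) // gerBl ler0n.
suff -> : 13 * Num.sqrt m%:R <= `|statistic s - expect p m statistic| by rewrite subrr.
by rewrite ler0_norm; lra.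
Qed.

Lemma tester_far p m eps theta : (0 < m)%N -> (0 < k)%N ->
  m%:R / (2 * k%:R) <= 8^-1 :> R ->
  0 <= eps -> eps < tv_dist p (@uniform_pmf R 'I_k) ->
  k%:R * tanh (m%:R / (2 * k%:R)) - m%:R ^+ 3 * eps ^+ 2 / (40 * k%:R ^+ 2)
    + 4^-1 + 15 * Num.sqrt m%:R < theta ->
  9 / 10 <= prob_rejects (tester theta m) p.
Proof.
move=> m0 k0 x8 e0 etv th; have E := expect_statistic_far m0 k0 x8 e0 etv.
rewrite prob_rejects_tester.
have := statistic_concentration p m0; set B := expect _ _ _ => HB.
have r0 := sqrtr_ge0 (m%:R : R).
apply: (@le_trans _ _ (1 - B)); first lra.
rewrite -[X in X - B](expect_cst p m 1) -expectB; apply: ler_expect => s.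
case: (lerP theta (statistic s)) => h; last first.
  by rewrite subr0 gerBl ler0n.
suff -> : 13 * Num.sqrt m%:R <= `|statistic s - expect p m statistic| by rewrite subrr.
by rewrite ger0_norm; lra.
Qed.

End Tester.

(** * Choice of sample size and threshold *)

Section TesterParams.
Variable R : realType.
Implicit Types (n : nat) (eps : R).

Lemma tv_dist_uniform_le1 k (p : fdist R 'I_k) : (0 < k)%N ->
  tv_dist p (@uniform_pmf R 'I_k) <= 1.
Proof.
move=> k0; rewrite /tv_dist ler_pdivrMl // mulr1.
apply: (@le_trans _ _ (\sum_(x : 'I_k) (p x + uniform_pmf R x))).
  apply: ler_sum => x _; rewrite (le_trans (ler_normB _ _)) //.
  by rewrite !ger0_norm ?pmf_ge0 // /uniform_pmf invr_ge0.
rewrite big_split /= pmf_sum1 /uniform_pmf sumr_const -[_ *+ _]mulr_natl.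
by rewrite mulfV // card_ord pnatr_eq0 -lt0n.
Qed.

Definition sample_scale n eps : R := (n%:R / eps) `^ (4 / 5).

(** For [eps >= 1] no distribution is eps-far, so no sample is drawn and threshold 0 always
    accepts. *)
Definition tester_size n eps : nat :=
  if eps < 1 then (Num.trunc (32 * sample_scale n eps)).+1 else 0.

(** For [eps < 1], the largest threshold that [tester_uniform] permits. *)
Definition tester_threshold n eps : R :=
  if eps < 1 then
    (2 * n)%:R * tanh ((tester_size n eps)%:R / (2 * (2 * n)%:R))
      - 15 * Num.sqrt (tester_size n eps)%:R
  else 0.

(** The fifth power removes the real exponent, reducing comparisons to polynomial ones. *)
Lemma sample_scale_pow5 n eps : 0 < eps -> sample_scale n eps ^+ 5 = (n%:R / eps) ^+ 4.
Proof.
move=> e0; rewrite /sample_scale -powR_mulrn ?powR_ge0 // -powRrM divfK ?pnatr_eq0 //.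
by rewrite powR_mulrn // divr_ge0 // ltW.
Qed.

Lemma sample_scale_ge1 n eps : (0 < n)%N -> 0 < eps < 1 -> 1 <= sample_scale n eps.
Proof.
move=> n0 /andP[e0 e1]; rewrite -(@ler_pXn2r _ 5) ?nnegrE ?powR_ge0 // sample_scale_pow5 //.
rewrite expr1n exprn_ege1 //.
by rewrite ler_pdivlMr // mul1r (le_trans (ltW e1)) // ler1n.
Qed.

(** The bound on [eps] gives [eps^4 n >= 2^40], so the fifth power of the scale is at most
    [n^5 / 2^40]. *)
Lemma sample_scale_le n eps : 0 < eps -> 2 ^+ 10 / n%:R `^ (1 / 4) <= eps -> (0 < n)%N ->
  sample_scale n eps <= n%:R / 2 ^+ 8.
Proof.
move=> e0 he n0; have N0 : 0 < n%:R :> R by rewrite ltr0n.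
set y := n%:R `^ (1 / 4) in he; have y0 : 0 < y by rewrite powR_gt0.
have y4 : y ^+ 4 = n%:R.
  by rewrite -powR_mulrn ?powR_ge0 // -powRrM divfK ?pnatr_eq0 // powRr1 // ltW.
have s5 := sample_scale_pow5 n e0.
rewrite -(@ler_pXn2r _ 5) ?nnegrE ?powR_ge0 ?divr_ge0 ?exprn_ge0 // s5.
rewrite ler_pdivrMr // in he.
have h4 : (2 ^+ 10) ^+ 4 <= eps ^+ 4 * n%:R.
  by rewrite -y4 -exprMn lerXn2r // nnegrE ?exprn_ge0 // mulr_ge0 // ltW.
rewrite !expr_div_n ler_pdivrMr ?exprn_gt0 // mulrAC ler_pdivlMr ?exprn_gt0 //.
rewrite [leRHS](_ : _ = n%:R ^+ 4 * (eps ^+ 4 * n%:R)); last by ring.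
rewrite ler_pM2l ?exprn_gt0 //; apply: le_trans h4.
by rewrite -!exprM.
Qed.

(** The scale is at least 1, which absorbs the rounding. *)
Lemma tester_size_itv n eps : (0 < n)%N -> 0 < eps < 1 ->
  32 * sample_scale n eps <= (tester_size n eps)%:R <= 33 * sample_scale n eps.
Proof.
move=> n0 e01; have s1 := sample_scale_ge1 n0 e01; case/andP: e01 => e0 e1.
rewrite /tester_size e1.
have s0 : 0 <= 32 * sample_scale n eps by rewrite mulr_ge0 // powR_ge0.
have /andP[h1 h2] := Num.Theory.trunc_itv s0.
rewrite (ltW h2) -natr1; lra.
Qed.

(** The gap must exceed [30 sqrt m + 1/4], for which [32 sqrt m] suffices when [m >= 1]. *)
Lemma uniformity_gap n eps (M : R) : (0 < n)%N -> 0 < eps -> 0 < M ->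
  32 * sample_scale n eps <= M ->
  32 * Num.sqrt M <= M ^+ 3 * eps ^+ 2 / (40 * (2 * n)%:R ^+ 2).
Proof.
move=> n0 e0 M0 hM; have N0 : 0 < n%:R :> R by rewrite ltr0n.
set r := Num.sqrt M; have r0 : 0 < r by rewrite sqrtr_gt0.
have rM : r ^+ 2 = M by rewrite sqr_sqrtr // ltW.
have h5 : 32 ^+ 5 * (n%:R / eps) ^+ 4 <= M ^+ 5.
  by rewrite -(sample_scale_pow5 n e0) -exprMn lerXn2r // nnegrE ?mulr_ge0 ?powR_ge0 // ltW.
(* The claim divided by [r] and cleared of denominators; its square follows from
   [25 * 2^20 <= 32^5]. *)
have key : 5 * 2 ^+ 10 * n%:R ^+ 2 <= r ^+ 5 * eps ^+ 2.
  rewrite -(@ler_pXn2r _ 2) ?nnegrE ?mulr_ge0 ?exprn_ge0 ?(ltW r0) ?(ltW e0) //.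
  have -> : (r ^+ 5 * eps ^+ 2) ^+ 2 = M ^+ 5 * eps ^+ 4 by rewrite -rM; ring.
  rewrite expr_div_n mulrA ler_pdivrMr ?exprn_gt0 // in h5.
  apply: le_trans h5.
  rewrite exprMn -[(n%:R ^+ 2) ^+ 2]exprM ler_pM2r ?exprn_gt0 //.
  have -> : 32 = 2 ^+ 5 :> R by rewrite -natrX.
  rewrite exprMn -!exprM (_ : 5 * 5 = 5 + 10 * 2)%N // exprD.
  by rewrite ler_wpM2r ?exprn_ge0 // -!natrX ler_nat.
rewrite natrM ler_pdivlMr ?mulr_gt0 ?exprn_gt0 ?mulr_gt0 // -rM.
have := ler_wpM2l (ltW r0) key; lra.
Qed.

End TesterParams.

Theorem theorem4p23 (R : realType) :
  exists (K C : R) (A : nat -> R -> trace_algorithm R),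
    [/\ 1 < K, 0 < C &
      exists n0 : nat, forall (n : nat) (eps : R),
        (n0 <= n)%N ->
        K * ln n%:R ^+ 3 / n%:R `^ (1 / 4) <= eps ->
        [/\ (sample_size (A n eps))%:R
              <= C * (n%:R / eps) `^ (4 / 5) * ln n%:R `^ (7 / 5),
            forall p : fdist R 'I_(2 * n),
              (forall x, p x = uniform_pmf R x) ->
              9 / 10 <= prob_accepts (A n eps) p
          & forall p : fdist R 'I_(2 * n),
              eps < tv_dist p (@uniform_pmf R 'I_(2 * n)) ->
              9 / 10 <= prob_rejects (A n eps) p]].
Proof.
(* K = 2 ^ 10 ensures m / (4 n) <= 1 / 8, as [tanh_tangent_strong] requires. *)
exists (2 ^+ 10), 33, (fun n eps => tester (tester_threshold n eps) (tester_size n eps)).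
split; [by rewrite exprn_egt1 ?ltr1n | by [] |].
exists (Num.trunc (expR 1 : R)).+1 => n eps hn heps.
have n0 : (0 < n)%N by exact: leq_trans hn.
have N0 : 0 < n%:R :> R by rewrite ltr0n.
have ln1 : 1 <= ln (n%:R : R).
  rewrite -ler_expR lnK ?posrE //.
  have /andP[_ h] := Num.Theory.trunc_itv (expR_ge0 (1 : R)).
  by rewrite (le_trans (ltW h)) // ler_nat.
have heps' : 2 ^+ 10 / n%:R `^ (1 / 4) <= eps.
  apply: le_trans heps; rewrite ler_wpM2r ?invr_ge0 ?powR_ge0 // ler_peMr //.
  exact: exprn_ege1.
have e0 : 0 < eps by apply: lt_le_trans heps'; rewrite divr_gt0 // powR_gt0.
have k0 : (0 < 2 * n)%N by rewrite muln_gt0.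
have [e1|e1] := ltrP eps 1; last first.
  rewrite /tester_size /tester_threshold ltNge e1 /=; split=> [|p pu|p etv].
  - by rewrite !mulr_ge0 ?powR_ge0.
  - by rewrite prob_accepts_tester0; lra.
  - by have := lt_le_trans etv (tv_dist_uniform_le1 p k0); rewrite ltNge e1.
have e01 : 0 < eps < 1 by rewrite e0.
have /andP[m1 m2] := tester_size_itv n0 e01.
have m0 : (0 < tester_size n eps)%N by rewrite /tester_size e1.
have x8 : (tester_size n eps)%:R / (2 * (2 * n)%:R) <= 8^-1 :> R.
  rewrite natrM ler_pdivrMr ?mulr_gt0 //.
  have := sample_scale_le e0 heps' n0; lra.
split=> [|p pu|p etv].
- rewrite (le_trans m2) // ler_peMr ?mulr_ge0 ?powR_ge0 //.
  rewrite -[leLHS](powRr0 (ln n%:R)) ler_powR //; lra.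
- apply: tester_uniform => //.
  by rewrite /tester_threshold e1 subrK.
- apply: tester_far etv _ => //; first exact: ltW.
  rewrite /tester_threshold e1.
  have M1 : 1 <= Num.sqrt (tester_size n eps)%:R :> R.
    by rewrite -[leLHS]sqrtr1 ler_wsqrtr ?ler1n.
  have M0 : 0 < (tester_size n eps)%:R :> R by rewrite ltr0n.
  have := uniformity_gap n0 e0 M0 m1; lra.
Qed.
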